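(* Let $X$ be a finite simplicial complex. Then the neighborhood complex $\mathcal{N}(G_{1,X})$ of the graph $G_{1,X}$ is homotopy equivalent to $X$ (that is, their geometric realizations are homotopy equivalent).
   Context: Graphs are undirected, and loops are allowed: a graph is $G=(V(G),E(G))$ with $E(G)\subseteq V(G)\times V(G)$ symmetric. For a finite (abstract) simplicial complex $X$, $G_{1,X}$ is the reflexive graph obtained from the $1$-skeleton of the first barycentric subdivision of $X$ by adding a loop at each vertex. Explicitly, $V(G_{1,X})$ is the set of all nonempty simplices of $X$, and $(\sigma,\tau)\in E(G_{1,X})$ if and only if $\sigma\subseteq\tau$ or $\tau\subseteq\sigma$ (in particular $(\sigma,\sigma)\in E(G_{1,X})$ for every $\sigma$). The neighborhood complex $\mathcal{N}(G)$ of a graph $G$ is the abstract simplicial complex whose vertices are the non-isolated vertices of $G$ and whose simplices are all those subsets of $V(G)$ having a common neighbor, i.e. subsets $A\subseteq V(G)$ for which there is $v\in V(G)$ with $(v,a)\in E(G)$ for all $a\in A$. *)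

(* Defs.v *)
From HB Require Import structures.
From mathcomp Require Import all_boot all_order all_algebra.
From mathcomp Require Import all_classical all_reals all_analysis.

Set Implicit Arguments.
Unset Strict Implicit.
Unset Printing Implicit Defensive.

Import Order.TTheory GRing.Theory Num.Theory.
Import numFieldNormedType.Exports.

(* Simplices are closed under passing to arbitrary subsets, so set0 is a simplex
   as soon as there is any simplex.  The vertices of the complex are the v with
   {v} a simplex; elements of V that are not vertices are allowed. *)
Record simplicial_complex (V : finType) := SimplicialComplex {
  simplices :> {set {set V}};
  simplices_closed : forall s t : {set V},
    s \in simplices -> t \subset s -> t \in simplices
}.

(* Loops are allowed: edge need not be irreflexive. *)
Record graph := Graph {
  vertex :> finType;
  edge : rel vertex;
  edge_sym : symmetric edge
}.

Section NeighborhoodComplex.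
Variable G : graph.

Definition common_neighbor_sets : {set {set G}} :=
  [set A : {set G} | [exists v, [forall a in A, edge v a]]]%SET.

Fact common_neighbor_sets_closed (s t : {set G}) :
  s \in common_neighbor_sets -> t \subset s -> t \in common_neighbor_sets.
Proof.
rewrite !inE => /existsP[v /forall_inP vs] /fintype.subsetP ts.
by apply/existsP; exists v; apply/forall_inP => a /ts; exact: vs.
Qed.

(* {a} has a common neighbor iff a is not isolated, so the vertices of this
   complex are exactly the non-isolated vertices of G. *)
Definition neighborhood_complex : simplicial_complex G :=
  SimplicialComplex common_neighbor_sets_closed.

End NeighborhoodComplex.

Section BarycentricGraph.
Variables (V : finType) (X : simplicial_complex V).

Definition nonempty_simplex : finType :=
  {s : {set V} | (s \in X) && (s != finset.set0)}.

Definition face_comparable : rel nonempty_simplex :=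
  fun s t => (val s \subset val t) || (val t \subset val s).

Fact face_comparable_sym : symmetric face_comparable.
Proof. by move=> s t; rewrite /face_comparable orbC. Qed.

(* The 1-skeleton of the barycentric subdivision with a loop at each vertex; the
   loops come from s \subset s. *)
Definition barycentric_graph : graph := Graph face_comparable_sym.

End BarycentricGraph.

Local Open Scope classical_set_scope.
Local Open Scope ring_scope.

Section Realization.
Variables (R : realType) (V : finType) (X : simplicial_complex V).

(* Barycentric coordinates in R^V, with the product topology. *)
Definition realization_set : set {ptws V -> R} :=
  [set x | [/\ forall v, 0 <= x v,
               \sum_(v : V) x v = 1
             & finset (fun v : V => x v != 0) \in X]].

(* set_type carries the topology induced from the ambient space. *)
Definition realization : topologicalType := set_type realization_set.

End Realization.

Section Homotopy.
Variable R : realType.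

(* H is total on T * R only for convenience: continuity is required on the
   subspace T x [0, 1], and the values elsewhere are arbitrary. *)
Definition homotopic (T U : topologicalType) (f g : T -> U) : Prop :=
  exists H : T * R -> U,
    [/\ {within [set: T] `*` `[0, 1], continuous H},
        forall x, H (x, 0) = f x
      & forall x, H (x, 1) = g x].

Definition homotopy_equivalent (T U : topologicalType) : Prop :=
  exists (f : T -> U) (g : U -> T),
    [/\ continuous f, continuous g,
        homotopic (g \o f) id & homotopic (f \o g) id].

End Homotopy.

(* Main.v *)
(* Write N for the neighborhood complex.  A point x of |N| is a weight on the
   nonempty simplices of X; let m_u be the total weight of the simplices
   containing the vertex u.  Let v be a common neighbor of supp x, and W the
   weight of those simplices in supp x that lie above v.  Then m >= W on v and
   m <= W off v, so every superlevel set of m is comparable with v, and the set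
   where m is maximal is a simplex of X.  Thresholding m at the level above
   which it spans a simplex of X defines f : |N| -> |X|.  Conversely
   g : |X| -> |N| sends y to a weight on the superlevel sets of y, which form a
   flag.  Since the superlevel sets of f x are superlevel sets of m, they have v
   as a common neighbor together with supp x: thus x and g (f x) lie in a common
   simplex of N, while supp (f (g y)) is contained in supp y.  Both composites are
   therefore homotopic to the identity along straight lines. *)
Require Import Defs.
From mathcomp Require Import all_boot all_order all_algebra.
From mathcomp Require Import all_classical all_reals all_analysis.

Set Implicit Arguments.
Unset Strict Implicit.
Unset Printing Implicit Defensive.

Import Order.TTheory GRing.Theory Num.Theory.
Import numFieldNormedType.Exports.

Local Open Scope classical_set_scope.
Local Open Scope ring_scope.

(** * Continuity of sums, products and positive parts *)

Section RealValuedContinuity.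
Variables (R : realType) (T : topologicalType).

Lemma continuous_sumr (I : Type) (r : seq I) (P : pred I) (F : I -> T -> R) :
  (forall i, P i -> continuous (F i)) ->
  continuous (fun x => \sum_(i <- r | P i) F i x).
Proof. by apply: continuous_big => x; exact: add_continuous. Qed.

Lemma continuous_prodr (I : Type) (r : seq I) (P : pred I) (F : I -> T -> R) :
  (forall i, P i -> continuous (F i)) ->
  continuous (fun x => \prod_(i <- r | P i) F i x).
Proof. by apply: continuous_big => x; exact: mul_continuous. Qed.

Lemma continuous_mulr (f g : T -> R) :
  continuous f -> continuous g -> continuous (fun x => f x * g x).
Proof. by move=> fc gc x; apply: cvgM; [exact: fc|exact: gc]. Qed.

Lemma continuous_addr (f g : T -> R) :
  continuous f -> continuous g -> continuous (fun x => f x + g x).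
Proof. by move=> fc gc x; apply: cvgD; [exact: fc|exact: gc]. Qed.

Lemma continuous_subr (f g : T -> R) :
  continuous f -> continuous g -> continuous (fun x => f x - g x).
Proof. by move=> fc gc x; apply: cvgB; [exact: fc|exact: gc]. Qed.

Lemma continuous_pos_part (f g : T -> R) :
  continuous f -> continuous g -> continuous (fun x => Num.max 0 (f x - g x)).
Proof.
move=> fc gc x; apply: (@continuous_max R T (fun=> 0) (fun x => f x - g x)).
  exact: cst_continuous.
exact: continuous_subr.
Qed.

End RealValuedContinuity.

(** * Maps into a realization, and straight-line homotopies *)

Section Coordinates.
Variables (R : realType) (V : finType) (X : simplicial_complex V).

Definition coord (x : realization R X) : V -> R := \val x.

Lemma coord_ge0 x v : 0 <= coord x v.
Proof. by have [+ _ _] := set_valP x; exact. Qed.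

Lemma coord_sum1 x : \sum_v coord x v = 1.
Proof. by have [_ + _] := set_valP x. Qed.

Lemma coord_supp x : finset (fun v => coord x v != 0) \in simplices X.
Proof. by have [_ _ +] := set_valP x. Qed.

Lemma coord_inj : injective coord.
Proof. exact: val_inj. Qed.

Lemma coord_gt0_ex x : exists v, 0 < coord x v.
Proof.
apply: contrapT => /forallNP x0; have := coord_sum1 x.
rewrite big1 => [/eqP|v _]; first by rewrite eq_sym oner_eq0.
by apply: le_anti; rewrite coord_ge0 leNgt andbT; exact/negP.
Qed.

Lemma coord_continuous v : continuous (coord ^~ v).
Proof.
move=> x; apply: (@continuous_comp _ {ptws V -> R} _
  (fun x : realization R X => \val x) (fun f => f v)).
  exact: (@initial_continuous _ _ set_val).
exact: (@proj_continuous V (fun=> R)).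
Qed.

Lemma realization_continuous (T : topologicalType) (F : T -> realization R X) :
  (forall v, continuous (fun x => coord (F x) v)) -> continuous F.
Proof.
move=> Fc; apply: continuous_comp_initial => x.
apply/cvg_sup => v.
exact: (@continuous_comp_initial _ _ _ (fun f : V -> R => f v)
          (fun x => \val (F x)) (Fc v)).
Qed.

Lemma realization_mapP (T : topologicalType) (h : T -> V -> R) :
  (forall v, continuous (h ^~ v)) ->
  (forall x v, 0 <= h x v) ->
  (forall x, \sum_v h x v = 1) ->
  (forall x, finset (fun v => h x v != 0) \in simplices X) ->
  exists2 F : T -> realization R X,
    continuous F & forall x v, coord (F x) v = h x v.
Proof.
move=> hc h0 h1 hX.
have hP x : h x \in realization_set X by apply/mem_set; split.
exists (fun x => Sub (h x) (hP x)) => //.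
by apply: realization_continuous => v; exact: hc.
Qed.

(** Allows a map to be given by unnormalized weights. The factor [c] stays abstract: later only
    signs and comparisons of coordinates matter. *)
Lemma normalized_mapP (T : topologicalType) (h : T -> V -> R) :
  (forall v, continuous (h ^~ v)) ->
  (forall x v, 0 <= h x v) ->
  (forall x, exists v, 0 < h x v) ->
  (forall x, finset (fun v => h x v != 0) \in simplices X) ->
  exists2 F : T -> realization R X,
    continuous F & forall x, exists2 c, 0 < c &
      forall v, coord (F x) v = c * h x v.
Proof.
move=> hc h0 hpos hX.
have s0 x : 0 < \sum_v h x v.
  have [v hv] := hpos x.
  by rewrite (bigD1 v) //= ltr_pwDl // sumr_ge0.
have [||||F Fc FE] := @realization_mapP T (fun x v => (\sum_w h x w)^-1 * h x v).
- move=> v; apply: continuous_mulr => // x; apply: cvgV.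
    by rewrite gt_eqF.
  exact: continuous_sumr.
- by move=> x v; rewrite mulr_ge0 // invr_ge0 ltW.
- by move=> x; rewrite -mulr_sumr mulVf // gt_eqF.
- move=> x; apply: simplices_closed (hX x) _.
  by apply/fintype.subsetP => v; rewrite !inE mulf_eq0 negb_or => /andP[].
by exists F => // x; exists (\sum_w h x w)^-1; rewrite ?invr_gt0.
Qed.

(** Both ends of the segment are supported in the simplex [s], hence so is every convex combination
    of them. *)
Lemma straight_line_homotopic (T : topologicalType)
    (f g : T -> realization R X) :
  continuous f -> continuous g ->
  (forall x, exists2 s, s \in simplices X &
     forall v, 0 < coord (f x) v \/ 0 < coord (g x) v -> v \in s) ->
  homotopic R f g.
Proof.
move=> fc gc fgX.
(* Clamps [t] to the unit interval, since the homotopy must be defined for every real time. *)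
pose c (t : R) : R := Num.max 0 (1 - Num.max 0 (1 - t)).
have c01 t : 0 <= c t <= 1.
  by rewrite /c le_max lexx ge_max ler01 gerBl le_max lexx.
have cc : continuous c.
  by do 2!(apply: continuous_pos_part; first exact: cst_continuous); move=> ?.
pose h (p : T * R) v : R :=
  (1 - c p.2) * coord (f p.1) v + c p.2 * coord (g p.1) v.
have cfst : continuous (fst : T * R -> T) by move=> p; exact: cvg_fst.
have csnd : continuous (c \o snd : T * R -> R).
  by move=> p; apply: continuous_comp; [exact: cvg_snd|exact: cc].
have ccoord (k : T -> realization R X) v :
    continuous k -> continuous (fun p : T * R => coord (k p.1) v).
  move=> kc p; apply: (@continuous_comp _ _ _ fst (fun x => coord (k x) v)).
    exact: cfst.
  apply: (@continuous_comp _ _ _ k (fun y => coord y v)); first exact: kc.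
  exact: coord_continuous.
have [||||H Hc HE] := @realization_mapP _ h.
- move=> v; apply: continuous_addr; apply: continuous_mulr; try exact: ccoord.
    by apply: continuous_subr => //; exact: cst_continuous.
  exact: csnd.
- move=> p v; have /andP[c0 c1] := c01 p.2.
  by rewrite addr_ge0 // mulr_ge0 ?coord_ge0 ?subr_ge0.
- by move=> p; rewrite big_split /= -!mulr_sumr !coord_sum1 !mulr1 subrK.
- move=> p; have [s sX sP] := fgX p.1.
  apply: simplices_closed sX _; apply/fintype.subsetP => v; rewrite inE => hv.
  apply: sP; rewrite !lt0r !coord_ge0 !andbT.
  apply/orP; apply: contraNT hv; rewrite negb_or !negbK => /andP[/eqP f0 /eqP g0].
  by rewrite /h f0 g0 !mulr0 addr0.
exists H; split.
- by apply: continuous_subspaceT => p; exact: Hc.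
- move=> x; apply/coord_inj/funext => v; rewrite HE /h /c /= subr0.
  by rewrite (max_r ler01) subrr maxxx subr0 mul1r mul0r addr0.
- move=> x; apply/coord_inj/funext => v; rewrite HE /h /c /= subrr.
  by rewrite maxxx subr0 (max_r ler01) subrr mul0r add0r mul1r.
Qed.

End Coordinates.

(** * Thresholding to a simplex, and weights on superlevel sets *)

Section Weights.
Variable R : realType.

Lemma pos_part_gt0 (a b : R) : (0 < Num.max 0 (a - b)) = (b < a).
Proof. by rewrite lt_max ltxx subr_gt0. Qed.

Lemma pos_part_ge0 (a b : R) : 0 <= Num.max 0 (a - b).
Proof. by rewrite le_max lexx. Qed.

Lemma prodr_gt0P (I : finType) (P : pred I) (F : I -> R) :
  (forall i, P i -> 0 <= F i) ->
  0 < \prod_(i | P i) F i <-> forall i, P i -> 0 < F i.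
Proof.
move=> F0; split=> [/lt0r_neq0/prodf_neq0 Fn0 i Pi|]; last exact: prodr_gt0.
by rewrite lt0r F0 // Fn0.
Qed.

Lemma sumr_gt0P (I : finType) (P : pred I) (F : I -> R) :
  (forall i, P i -> 0 <= F i) ->
  0 < \sum_(i | P i) F i <-> exists2 i, P i & 0 < F i.
Proof.
move=> F0; split=> [/gt_eqF/negbT|[i Pi Fi]].
  by rewrite psumr_neq0 // => /hasP[i _ /andP[Pi Fi]]; exists i.
by rewrite (bigD1 i) //= ltr_pwDl // sumr_ge0 // => j /andP[Pj _]; exact: F0.
Qed.

Lemma argmax_ex (V : finType) (m : V -> R) (u0 : V) :
  exists u, forall w, m w <= m u.
Proof.
have [//|u _ mu] := @Order.TotalTheory.arg_maxP _ _ V u0 predT m.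
by exists u => w; exact: mu.
Qed.

Variables (V : finType) (X : simplicial_complex V).

(* [m] thresholded at the level above which it spans a simplex: a vertex
   survives iff every non-simplex contains a strictly lower vertex. *)
Definition simplex_part (m : V -> R) (u : V) : R :=
  m u * \prod_(B : {set V} | B \notin simplices X)
          \sum_(w in B) Num.max 0 (m u - m w).

(* Supported on the superlevel sets of [y], hence on a flag. *)
Definition flag_weight (y : V -> R) (a : {set V}) : R :=
  \prod_(u in a) (y u * \prod_(w | w \notin a) Num.max 0 (y u - y w)).

Section SimplexPart.
Variable m : V -> R.
Hypothesis m0 : forall u, 0 <= m u.

Let defect_ge0 u (B : {set V}) : 0 <= \sum_(w in B) Num.max 0 (m u - m w).
Proof. by apply: sumr_ge0 => w _; exact: pos_part_ge0. Qed.

Lemma simplex_part_ge0 u : 0 <= simplex_part m u.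
Proof. by rewrite mulr_ge0 // prodr_ge0. Qed.

Lemma simplex_part_gt0P u :
  0 < simplex_part m u <->
  0 < m u /\
  forall B : {set V}, B \notin simplices X -> exists2 w, w \in B & m w < m u.
Proof.
have prodP := @prodr_gt0P _ (fun B : {set V} => B \notin simplices X) _
  (fun B _ => defect_ge0 u B).
have sumP B := @sumr_gt0P _ (fun w => w \in B) _
  (fun w _ => pos_part_ge0 (m u) (m w)).
rewrite /simplex_part; split=> [h|[mu hB]].
  have mu : 0 < m u.
    by rewrite lt0r m0 andbT; apply: contraTneq h => ->; rewrite mul0r ltxx.
  split=> // B BX; move: h; rewrite pmulr_rgt0 // => /prodP/(_ B BX)/sumP[w wB].
  by rewrite pos_part_gt0; exists w.
rewrite mulr_gt0 //; apply/prodP => B /hB[w wB wu]; apply/sumP; exists w => //.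
by rewrite pos_part_gt0.
Qed.

(** Every factor grows with the value of [m] at the vertex. Hence a strict inequality between
    simplex parts already holds for [m]. *)
Lemma simplex_part_le u w : m u <= m w -> simplex_part m u <= simplex_part m w.
Proof.
move=> uw; apply: ler_pM => //; first exact: prodr_ge0.
apply: ler_prod => B _; rewrite defect_ge0 /=; apply: ler_sum => z _.
by rewrite ge_max pos_part_ge0 /= le_max lerB ?orbT.
Qed.

(** If the nonempty support were not a simplex, it would be one of the sets [B] in the product, and
    its lowest vertex would need a strictly lower one inside it. *)
Lemma simplex_part_supp : (exists u, 0 < simplex_part m u) ->
  finset (fun u => simplex_part m u != 0) \in simplices X.
Proof.
case=> u0 hu0; set S := finset _; apply: contraT => SX.
have inS u : u \in S -> 0 < simplex_part m u.
  by rewrite inE lt0r simplex_part_ge0 andbT.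
have u0S : u0 \in S by rewrite inE gt_eqF.
have [u uS umin] := @Order.TotalTheory.arg_minP _ _ V u0 (mem S) m u0S.
have /simplex_part_gt0P[_ /(_ S SX)[w wS]] := inS u uS.
by rewrite ltNge (umin w wS).
Qed.

End SimplexPart.

Section FlagWeight.
Variable y : V -> R.
Hypothesis y0 : forall u, 0 <= y u.

Let gap_ge0 u (a : {set V}) : 0 <= \prod_(w | w \notin a) Num.max 0 (y u - y w).
Proof. by apply: prodr_ge0 => w _; exact: pos_part_ge0. Qed.

Lemma flag_weight_ge0 a : 0 <= flag_weight y a.
Proof. by apply: prodr_ge0 => u _; rewrite mulr_ge0. Qed.

Lemma flag_weight_gt0P (a : {set V}) :
  0 < flag_weight y a <->
  forall u, u \in a -> 0 < y u /\ forall w, w \notin a -> y w < y u.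
Proof.
have gapP u := @prodr_gt0P _ (fun w => w \notin a) _
  (fun w _ => pos_part_ge0 (y u) (y w)).
have prodP := @prodr_gt0P _ (fun u => u \in a) _
  (fun u _ => mulr_ge0 (y0 u) (gap_ge0 u a)).
split=> [/prodP h u ua|h]; last first.
  apply/prodP => u /h[yu uw]; rewrite mulr_gt0 //.
  by apply/gapP => w /uw; rewrite pos_part_gt0.
have hu := h u ua; have yu : 0 < y u.
  by rewrite lt0r y0 andbT; apply: contraTneq hu => ->; rewrite mul0r ltxx.
split=> // w wa; rewrite -pos_part_gt0.
by move: hu; rewrite pmulr_rgt0 // => /gapP; exact.
Qed.

(** If [u] were in [a] but not [b], and [w] in [b] but not [a], then [y w < y u < y w]. *)
Lemma flag_weight_chain (a b : {set V}) :
  0 < flag_weight y a -> 0 < flag_weight y b -> (a \subset b) || (b \subset a).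
Proof.
move=> /flag_weight_gt0P ha /flag_weight_gt0P hb.
have [//|/subsetPn[u ua ub]] := boolP (a \subset b).
apply/fintype.subsetP => w wb; apply: contraT => wa.
by have := lt_trans ((ha u ua).2 w wa) ((hb w wb).2 u ub); rewrite ltxx.
Qed.

End FlagWeight.

Lemma continuous_simplex_part (T : topologicalType) (m : T -> V -> R) u :
  (forall w, continuous (m ^~ w)) -> continuous (fun x => simplex_part (m x) u).
Proof.
move=> mc; apply: continuous_mulr => //; apply: continuous_prodr => B _.
by apply: continuous_sumr => w _; exact: continuous_pos_part.
Qed.

Lemma continuous_flag_weight (T : topologicalType) (y : T -> V -> R) a :
  (forall w, continuous (y ^~ w)) -> continuous (fun x => flag_weight (y x) a).
Proof.
move=> yc; apply: continuous_prodr => u _; apply: continuous_mulr => //.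
by apply: continuous_prodr => w _; exact: continuous_pos_part.
Qed.

End Weights.

(** * Vertex masses of a weight on the nonempty simplices *)

Section BarycentricNeighborhood.
Variables (R : realType) (V : finType) (X : simplicial_complex V).

Notation P := (nonempty_simplex X).
Notation N := (neighborhood_complex (barycentric_graph X)).

Lemma nonempty_simplexP (a : P) : val a \in simplices X /\ exists u, u \in val a.
Proof. by have /andP[aX /set0Pn] := valP a. Qed.

Lemma neighborhoodP (A : {set P}) :
  A \in simplices N <-> exists v : P, forall a, a \in A -> face_comparable v a.
Proof.
rewrite inE; split=> [/existsP[v /forall_inP vA]|[v vA]].
  by exists v.
by apply/existsP; exists v; apply/forall_inP.
Qed.

Definition vertex_mass (x : P -> R) (u : V) : R := \sum_(a : P | u \in val a) x a.

Section Mass.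
Variable x : P -> R.
Hypothesis x0 : forall a, 0 <= x a.

Lemma vertex_mass_ge0 u : 0 <= vertex_mass x u.
Proof. exact: sumr_ge0. Qed.

Lemma vertex_mass_gt0P u :
  0 < vertex_mass x u <-> exists2 a : P, u \in val a & 0 < x a.
Proof. exact: sumr_gt0P. Qed.

Section CommonNeighbor.
Variable v : P.
Hypothesis v_nbr : forall a, 0 < x a -> face_comparable v a.

(* The mass of the faces lying above [v] separates the vertex masses inside [v]
   from those outside. *)
Let upper_mass : R := \sum_(a : P | ~~ (val a \subset val v)) x a.

Let upperW a : 0 < x a -> ~~ (val a \subset val v) -> val v \subset val a.
Proof. by move=> /v_nbr/orP[//|->]. Qed.

(** Faces of weight zero contribute nothing, so the predicates need comparing only on the support of
    [x]. *)
Let sum_le_sum (Q Q' : pred P) :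
  (forall a, 0 < x a -> Q a -> Q' a) ->
  \sum_(a | Q a) x a <= \sum_(a | Q' a) x a.
Proof.
move=> QQ'; rewrite big_mkcond [leRHS]big_mkcond; apply: ler_sum => a _.
case: ifPn => Qa; last by case: ifPn.
have [xa|] := ltP 0 (x a); first by rewrite QQ'.
by case: ifP => // _ xa; exact: le_trans xa _.
Qed.

Lemma upper_mass_le u : u \in val v -> upper_mass <= vertex_mass x u.
Proof.
by move=> uv; apply: sum_le_sum => a xa /(upperW xa)/fintype.subsetP; exact.
Qed.

Lemma le_upper_mass u : u \notin val v -> vertex_mass x u <= upper_mass.
Proof.
move=> uv; apply: sum_le_sum => a xa ua.
by apply: contraNN uv => /fintype.subsetP; exact.
Qed.

Lemma vertex_mass_le u w :
  u \in val v -> w \notin val v -> vertex_mass x w <= vertex_mass x u.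
Proof. by move=> /upper_mass_le uv /le_upper_mass /le_trans; exact. Qed.

(** The face [a] counts in the mass at [u] but not in [upper_mass], while every weighted face
    counted in [upper_mass] contains [v] and hence [u]. *)
Lemma upper_mass_lt a u : 0 < x a -> val a \subset val v -> u \in val a ->
  upper_mass < vertex_mass x u.
Proof.
move=> xa av ua; rewrite /vertex_mass (bigD1 a) //= addrC ltr_pwDr //.
apply: sum_le_sum => b xb bv; apply/andP; split.
  have /fintype.subsetP := upperW xb bv; apply.
  by move/fintype.subsetP: av; exact.
by apply: contraNneq bv => ->.
Qed.

Lemma top_vertex_mass_simplex u (B : {set V}) : \sum_a x a = 1 ->
  (forall w, vertex_mass x w <= vertex_mass x u) ->
  (forall w, w \in B -> vertex_mass x u <= vertex_mass x w) ->
  B \in simplices X.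
Proof.
move=> x1 umax uB.
have [vX [u0 u0v]] := nonempty_simplexP v.
have [[a xa av]|noa] := pselect (exists2 a, 0 < x a & val a \subset val v).
  (* Some weighted face lies in [v]: the maximal mass then exceeds [upper_mass], which bounds the
     mass off [v], so [B] lies in [v]. *)
  have [_ [w wa]] := nonempty_simplexP a.
  apply: simplices_closed vX _; apply/fintype.subsetP => z zB.
  apply: contraT => /le_upper_mass zv.
  have := lt_le_trans (upper_mass_lt xa av wa) (umax w).
  by rewrite ltNge (le_trans (uB z zB)).
(* Otherwise all weighted faces contain [v], so the maximal mass is 1. Each vertex of [B] then has
   mass 1 and lies in every weighted face, in particular in [a]. *)
have [a _ xa] : exists2 a, predT a & 0 < x a.
  by apply/sumr_gt0P => //; rewrite x1.
have [aX _] := nonempty_simplexP a.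
apply: simplices_closed aX _; apply/fintype.subsetP => z zB.
apply: contraT => za.
have m1 : 1 <= vertex_mass x z.
  apply: le_trans (uB z zB); apply: le_trans (umax u0); rewrite -x1.
  apply: sum_le_sum => b xb _.
  have /fintype.subsetP : val v \subset val b.
    by apply: upperW => //; apply/negP => bv; apply: noa; exists b.
  exact.
suff : vertex_mass x z < 1 by rewrite ltNge m1.
rewrite -x1 (bigD1 a) //= ltr_pwDl //.
by apply: sum_le_sum => b _; apply: contraTneq => ->.
Qed.

(** A vertex of maximal mass survives the thresholding: a set without a strictly lower vertex is a
    simplex by [top_vertex_mass_simplex]. This makes normalization possible. *)
Lemma simplex_part_mass_gt0 : \sum_a x a = 1 ->
  exists u, 0 < simplex_part X (vertex_mass x) u.
Proof.
move=> x1; have [_ [u0 _]] := nonempty_simplexP v.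
have [u umax] := argmax_ex (vertex_mass x) u0.
have [a _ xa] : exists2 a, predT a & 0 < x a.
  by apply/sumr_gt0P => //; rewrite x1.
have [_ [w wa]] := nonempty_simplexP a.
exists u; apply/simplex_part_gt0P; first exact: vertex_mass_ge0.
split=> [|B BX].
  by apply: lt_le_trans (umax w); apply/vertex_mass_gt0P; exists a.
apply: contrapT => noz; move/negP: BX; apply.
apply: top_vertex_mass_simplex x1 umax _ => z zB.
by rewrite leNgt; apply/negP => zu; apply: noz; exists z.
Qed.

(* Superlevel sets of the vertex mass are nested with [v]. *)
Lemma flag_weight_mass_comparable (c : R) (y : V -> R) (b : P) : 0 < c ->
  (forall u, y u = c * simplex_part X (vertex_mass x) u) ->
  0 < flag_weight y (val b) -> face_comparable v b.
Proof.
move=> c0 yE.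
have y0 u : 0 <= y u.
  by rewrite yE mulr_ge0 ?(ltW c0) ?simplex_part_ge0 //; exact: vertex_mass_ge0.
move=> /(flag_weight_gt0P y0) hb.
have [vb|/subsetPn[w wv wb]] := boolP (val v \subset val b).
  by rewrite /face_comparable vb.
apply/orP; right; apply/fintype.subsetP => u ub; apply: contraT => uv.
have [_ /(_ w wb)] := hb u ub.
rewrite !yE ltr_pM2l // ltNge simplex_part_le //; first exact: vertex_mass_ge0.
exact: vertex_mass_le.
Qed.

End CommonNeighbor.
End Mass.

(** * The two maps between the realizations *)

Lemma flag_weight_gt0_ex (y : realization R X) :
  exists a : P, 0 < flag_weight (coord y) (val a).
Proof.
have [u0 yu0] := coord_gt0_ex y.
have [u umax] := argmax_ex (coord y) u0.
have yu : 0 < coord y u := lt_le_trans yu0 (umax u0).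
(* The top superlevel set, where [y] attains its maximum, always carries positive weight. *)
pose a : {set V} := finset (fun w => coord y w == coord y u).
have aP : (a \in simplices X) && (a != finset.set0).
  apply/andP; split; last by apply/set0Pn; exists u; rewrite inE.
  apply: simplices_closed (coord_supp y) _.
  by apply/fintype.subsetP => w; rewrite !inE => /eqP ->; rewrite gt_eqF.
exists (Sub a aP); apply/flag_weight_gt0P; first exact: coord_ge0.
move=> w; rewrite SubK inE => /eqP ->; split=> // z.
by rewrite inE lt_neqAle umax andbT.
Qed.

Lemma common_neighbor_ex (x : realization R N) :
  exists v : P, forall a : P, 0 < coord x a -> face_comparable v a.
Proof.
have /neighborhoodP[v vP] := coord_supp x; exists v => a xa.
by apply: vP; rewrite inE gt_eqF.
Qed.

Lemma to_complexP : exists2 f : realization R N -> realization R X,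
  continuous f & forall x, exists2 c, 0 < c &
    forall u, coord (f x) u = c * simplex_part X (vertex_mass (coord x)) u.
Proof.
have pos (x : realization R N) : exists u, 0 < simplex_part X (vertex_mass (coord x)) u.
  have [v vP] := common_neighbor_ex x.
  apply: simplex_part_mass_gt0 vP _; [exact: coord_ge0|exact: coord_sum1].
have m0 x := @vertex_mass_ge0 _ (@coord_ge0 _ _ _ x).
apply: normalized_mapP => // [u|x u|x].
- apply: continuous_simplex_part => w; apply: continuous_sumr => a _.
  exact: coord_continuous.
- exact: simplex_part_ge0.
- exact: simplex_part_supp.
Qed.

Lemma to_neighborhoodP : exists2 g : realization R X -> realization R N,
  continuous g & forall y, exists2 c, 0 < c &
    forall a : P, coord (g y) a = c * flag_weight (coord y) (val a).
Proof.
have y0 := @coord_ge0 R V X.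
apply: (@normalized_mapP R P N _ (fun y a => flag_weight (coord y) (val a))).
- by move=> a; apply: continuous_flag_weight => w; exact: coord_continuous.
- by move=> y a; exact: flag_weight_ge0.
- exact: flag_weight_gt0_ex.
(* The support is a flag, so any one of its members is a common neighbor of them all. *)
- move=> y; have [v hv] := flag_weight_gt0_ex y.
  apply/neighborhoodP; exists v => a; rewrite inE => ha.
  by apply: flag_weight_chain hv _ => //; rewrite lt0r ha flag_weight_ge0.
Qed.

End BarycentricNeighborhood.

Theorem theorem1p2 (R : realType) (V : finType) (X : simplicial_complex V) :
  homotopy_equivalent R
    (realization R (neighborhood_complex (barycentric_graph X)))
    (realization R X).
Proof.
have [f fc fE] := to_complexP R X.
have [g gc gE] := to_neighborhoodP R X.
exists f, g; split => //.
- apply: straight_line_homotopic => [x|x|x]; [|exact: cvg_id|].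
    by apply: continuous_comp; [exact: fc|exact: gc].
  have [v vP] := common_neighbor_ex x.
  (* All neighbors of [v] form one simplex, containing the supports of both [x] and [g (f x)]. *)
  exists (finset (fun a => face_comparable v a)).
    by apply/neighborhoodP; exists v => a; rewrite inE.
  move=> a; rewrite inE => -[|/vP//]; rewrite /comp.
  have [c c0 ->] := gE (f x); have [d d0 fxE] := fE x.
  rewrite pmulr_rgt0 //.
  exact: (flag_weight_mass_comparable (@coord_ge0 _ _ _ x) vP d0 fxE).
- apply: straight_line_homotopic => [y|y|y]; [|exact: cvg_id|].
    by apply: continuous_comp; [exact: gc|exact: fc].
  (* A vertex in the support of [f (g y)] has positive mass, so it lies in a face weighted by [g y];
     on such a face [y] is positive. *)
  exists (finset (fun u => coord y u != 0)); first exact: coord_supp.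
  move=> u; rewrite inE => -[|/gt_eqF->//]; rewrite /comp.
  have [c c0 ->] := fE (g y); have [d d0 gyE] := gE y.
  have y0 := @coord_ge0 R V X y; have gy0 := @coord_ge0 R _ _ (g y).
  rewrite pmulr_rgt0 // => /(simplex_part_gt0P _ (vertex_mass_ge0 gy0))[+ _].
  move=> /(vertex_mass_gt0P gy0)[a ua]; rewrite gyE pmulr_rgt0 //.
  by move=> /(flag_weight_gt0P y0)/(_ u ua)[/gt_eqF-> _].
Qed.
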